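(* Let $E\in\mathcal M(I_0,\{n_k\},\{c_k\})$ be a homogeneous Moran set for which there exist two sequences of nonnegative real numbers $\{L_k\}_{k\ge1}$ and $\{R_k\}_{k\ge1}$ such that $\eta_{\sigma,0}=L_{k+1}$ and $\eta_{\sigma,n_{k+1}}=R_{k+1}$ for every $k\ge0$ and every $\sigma\in D_k$. Suppose that at least one of the following three conditions is satisfied: (A) there exists $\omega_1>0$ such that $\bar\alpha_k\le\omega_1\underline\alpha_k$ for all $k\ge1$; (B) there exists $\omega_2>0$ such that $\bar\alpha_k\le\omega_2\,c_1c_2\cdots c_k$ for all $k\ge1$; (C) there exists $\omega_3>0$ such that $n_k\underline\alpha_k\ge\omega_3\,c_1c_2\cdots c_{k-1}$ for all $k\ge1$ (the empty product being $1$). Then $$\dim_H E=\liminf_{k\to\infty}\frac{\log (n_1n_2\cdots n_k)}{-\log(\delta_k-L_{k+1}-R_{k+1})}.$$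
   Context: Let $\{n_k\}_{k\ge1}$ be integers with $n_k\ge2$ and $\{c_k\}_{k\ge1}$ positive reals with $n_kc_k<1$ for all $k$. Let $D_0=\{\emptyset\}$ (empty word), $D_k=\{i_1i_2\cdots i_k:1\le i_j\le n_j,\ 1\le j\le k\}$ for $k\ge1$, $D=\bigcup_{k\ge0}D_k$; $\sigma*\tau$ denotes concatenation of words. $|A|$ denotes the diameter of $A\subset\mathbb R$. Homogeneous Moran set: let $I_0=[0,1]$ and let $\{I_\sigma:\sigma\in D\}$ be closed subintervals of $I_0$ such that (1) $I_\emptyset=I_0$; (2) for every $k\ge1$ and $\sigma\in D_{k-1}$, $I_{\sigma*1},\dots,I_{\sigma*n_k}$ are closed subintervals of $I_\sigma$ with $\min(I_{\sigma*(l+1)})\ge\max(I_{\sigma*l})$ for $1\le l\le n_k-1$; (3) for every $k\ge1$, $\sigma\in D_{k-1}$, $1\le i\le n_k$, $|I_{\sigma*i}|/|I_\sigma|=c_k$. Then $E=\bigcap_{k\ge0}\bigcup_{\sigma\in D_k}I_\sigma$ is called a homogeneous Moran set, and $\mathcal M(I_0,\{n_k\},\{c_k\})$ is the class of all such sets (each considered together with its intervals $I_\sigma$). For $k\ge1$, $\sigma\in D_{k-1}$, $1\le i\le n_k-1$ put $\eta_{\sigma,0}=\min(I_{\sigma*1})-\min(I_\sigma)$, $\eta_{\sigma,i}=\min(I_{\sigma*(i+1)})-\max(I_{\sigma*i})$, $\eta_{\sigma,n_k}=\max(I_\sigma)-\max(I_{\sigma*n_k})$. Put $\bar\alpha_k=\max\{\eta_{\sigma,j}:\sigma\in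 D_{k-1},1\le j\le n_k-1\}$, $\underline\alpha_k=\min\{\eta_{\sigma,j}:\sigma\in D_{k-1},1\le j\le n_k-1\}$, $\delta_k=c_1c_2\cdots c_k$ (the length of each $I_\sigma$, $\sigma\in D_k$). $\dim_H$ is Hausdorff dimension. *)

(* Defs.v *)
From HB Require Import structures.
From mathcomp Require Import all_boot all_order all_algebra.
From mathcomp Require Import all_classical all_reals all_analysis.

Set Implicit Arguments.
Unset Strict Implicit.
Unset Printing Implicit Defensive.

Import Order.TTheory GRing.Theory Num.Theory.

Local Open Scope classical_set_scope.
Local Open Scope ring_scope.

(** * Hausdorff measure and dimension of subsets of the line *)

Section Hausdorff.
Context {R : realType}.
Implicit Types (A U : set R) (s e : R).

(* Extended-real valued, so that [diam A <= e%:E] entails that A is bounded;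
   the empty set gets -oo. *)
Definition diam A : \bar R :=
  ereal_sup [set `|x - y|%:E | x in A & y in A].

(* |U|^s, with |U|^0 = 1 for nonempty U, while empty members of a cover do not
   contribute, even for s = 0. *)
Definition diam_pow s U : \bar R :=
  if U == set0 then 0%E else (diam U `^ s)%E.

Definition hausdorff_content s e A : \bar R :=
  ereal_inf [set (\sum_(0 <= i <oo) diam_pow s (U i))%E | U in
    [set U : nat -> set R |
      A `<=` \bigcup_i U i /\ forall i, (diam (U i) <= e%:E)%E]].

Definition hausdorff_measure s A : \bar R :=
  ereal_sup [set hausdorff_content s e A | e in [set e | 0 < e]].

Definition hausdorff_dim A : \bar R :=
  ereal_inf [set s%:E | s in [set s | 0 <= s /\ hausdorff_measure s A = 0%E]].

End Hausdorff.

(** * Homogeneous Moran sets *)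

(* Sequences indexed by k >= 1 are functions on nat whose value at 0 is never
   used.  A word i_1 ... i_k is the list [:: i_1; ...; i_k]; its letters start
   at 1, and its letter i_(j+1) is [nth 0 s j]. *)

Section Moran.
Context {R : realType}.
Variables (n : nat -> nat) (c : nat -> R).

Definition words (k : nat) : set (seq nat) :=
  [set s | size s = k /\
           forall j, (j < k)%N -> (1 <= nth 0%N s j <= n j.+1)%N].

(* The closed intervals I_s are given by their endpoints lo s = min I_s and
   hi s = max I_s. *)
Variables lo hi : seq nat -> R.

Definition moran_itv (s : seq nat) : set R := `[lo s, hi s]%classic.

Record homogeneous_moran : Prop := HomogeneousMoran {
  moran_le : forall k s, words k s -> lo s <= hi s ;
  moran_root : moran_itv [::] = `[0, 1]%classic ;
  moran_sub : forall k s i, (1 <= k)%N -> words k.-1 s -> (1 <= i <= n k)%N ->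
    moran_itv (rcons s i) `<=` moran_itv s ;
  moran_ordered : forall k s l, (1 <= k)%N -> words k.-1 s ->
    (1 <= l <= n k - 1)%N -> hi (rcons s l) <= lo (rcons s l.+1) ;
  moran_ratio : forall k s i, (1 <= k)%N -> words k.-1 s ->
    (1 <= i <= n k)%N ->
    (hi (rcons s i) - lo (rcons s i)) / (hi s - lo s) = c k
}.

Definition moran_set : set R :=
  \bigcap_(k in [set: nat]) \bigcup_(s in words k) moran_itv s.

(* For s of length k, eta s j is the left end gap if j = 0, the right end gap
   if j = n_(k+1), and the gap between the j-th and (j+1)-st child otherwise. *)
Definition eta (s : seq nat) (j : nat) : R :=
  if j == 0%N then lo (rcons s 1%N) - lo s
  else if j == n (size s).+1 then hi s - hi (rcons s j)
  else lo (rcons s j.+1) - hi (rcons s j).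

Definition inner_gaps (k : nat) : set R :=
  [set eta s j | s in words k.-1 & j in [set j | (1 <= j <= n k - 1)%N]].

(* The set inner_gaps k is finite, and nonempty when n k >= 2, so that these
   are its maximum and its minimum. *)
Definition alpha_max (k : nat) : R := sup (inner_gaps k).
Definition alpha_min (k : nat) : R := inf (inner_gaps k).

Definition delta (k : nat) : R := \prod_(1 <= i < k.+1) c i.

End Moran.

(* Main.v *)
(* Let l_k = delta_k - L_(k+1) - R_(k+1) be the length of the convex hull J_s of the
   children of I_s, |s| = k, and N_k = n_1 ... n_k.  The J_s cover E, which
   bounds the dimension from above.  Conversely, each of (A), (B), (C) yields
   l_(k-1) <= C n_k (delta_k + min gap at level k).  An interval V with
   l_k <= |V| < l_(k-1) meets at most two J_s, |s| = k-1, hence, by this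
   inequality, at most 4 + 2 C n_k |V| / l_(k-1) intervals of level k.  If s is
   below the liminf, 1 <= N_k l_k^s eventually and s <= 1, so that V meets at
   most a fraction (4 + 2 C) |V|^s of the intervals of any deeper level, and E
   has positive s-dimensional measure. *)
Require Import Defs.
From mathcomp Require Import all_boot all_order all_algebra.
From mathcomp Require Import all_classical all_reals all_analysis.
From mathcomp Require Import ring lra zify.

Set Implicit Arguments.
Unset Strict Implicit.
Unset Printing Implicit Defensive.

Import Order.TTheory GRing.Theory Num.Theory.
Import numFieldNormedType.Exports.

Local Open Scope classical_set_scope.
Local Open Scope ring_scope.

(** * Tails of inferior limits *)

Section Limits.
Context {R : realType}.
Local Open Scope ereal_scope.
Implicit Types (u : nat -> \bar R) (x : \bar R).

Lemma lt_limn_einf u x : x < limn_einf u ->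
  exists k0, forall k, (k0 <= k)%N -> x <= u k.
Proof.
rewrite limn_einf_lim (cvg_lim _ (@cvg_einfs_sup _ u))//.
move=> /ereal_sup_gt[_ [k0 _ <-]] xk0; exists k0 => k k0k.
by rewrite (le_trans (ltW xk0))// ereal_inf_lbound//; exists k.
Qed.

Lemma limn_einf_lt u x : limn_einf u < x ->
  forall k0, exists2 k, (k0 <= k)%N & u k < x.
Proof.
rewrite limn_einf_lim (cvg_lim _ (@cvg_einfs_sup _ u))// => ux k0.
have /ereal_inf_lt[_ [k k0k <-] ukx] : einfs u k0 < x.
  by rewrite (le_lt_trans _ ux)// ereal_sup_ubound//; exists k0.
by exists k.
Qed.

Lemma limn_einf_ge u x : (forall k, x <= u k) -> x <= limn_einf u.
Proof.
move=> xu; rewrite limn_einf_lim (cvg_lim _ (@cvg_einfs_sup _ u))//.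
apply: (@le_trans _ _ (einfs u 0%N)); last by rewrite ereal_sup_ubound//; exists 0%N.
by apply: le_ereal_inf_tmp => _ [k _ <-].
Qed.

End Limits.

(** * Diameters and estimates of Hausdorff content *)

Section Diameter.
Context {R : realType}.
Implicit Types (U : set R) (a b s : R).

Lemma diam_ge0 U : U !=set0 -> (0 <= diam U)%E.
Proof.
move=> [x Ux]; apply: ereal_sup_ubound; exists x => //; exists x => //.
by rewrite subrr normr0.
Qed.

Lemma diam_itv_le a b : a <= b -> (diam `[a, b]%classic <= (b - a)%:E)%E.
Proof.
move=> ab; apply: ge_ereal_sup => _ [x + [y + <-]].
rewrite /= !in_itv/= => /andP[ax xb] /andP[ay yb].
by rewrite lee_fin ler_norml; apply/andP; split; lra.
Qed.

Lemma diam_pow_ge0 s U : (0 <= diam_pow s U)%E.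
Proof. by rewrite /diam_pow; case: ifP => // _; exact: poweR_ge0. Qed.

Lemma diam_pow_set0 s : diam_pow s (@set0 R) = 0%E.
Proof. by rewrite /diam_pow eqxx. Qed.

Lemma diam_pow_itv_le s a b : 0 <= s -> a <= b ->
  (diam_pow s `[a, b]%classic <= ((b - a) `^ s)%:E)%E.
Proof.
move=> s0 ab; rewrite /diam_pow; case: ifPn => [_|/set0P ne].
  by rewrite lee_fin powR_ge0.
rewrite -poweR_EFin; apply: gt0_ler_poweR => //.
- by rewrite in_itv/= leey diam_ge0.
- by rewrite in_itv/= leey lee_fin subr_ge0 ab.
- exact: diam_itv_le.
Qed.

(* The slack [t] pays for replacing a set of diameter 0 by a genuine interval. *)
Lemma diam_pow_fatten s e t U : 0 <= s -> 0 < e -> 0 < t -> U !=set0 ->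
  (diam U <= e%:E)%E ->
  exists x r, [/\ 0 < r <= e, U `<=` `]x - 2 * r, x + 2 * r[%classic &
    ((r `^ s)%:E <= diam_pow s U + t%:E)%E].
Proof.
move=> s0 e0 t0 [x Ux] Ue; exists x.
have U0 : (0 <= diam U)%E by apply: diam_ge0; exists x.
have dist y : U y -> (`|x - y|%:E <= diam U)%E.
  by move=> Uy; apply: ereal_sup_ubound; exists x => //; exists y.
rewrite /diam_pow ifF; last by apply/negbTE/set0P; exists x.
move: U0 Ue dist; case: (diam U) => [d| |] //.
rewrite !lee_fin => d0 de dist.
suff [r [/andP[r0 re] dr rt]] : exists r, [/\ 0 < r <= e, d <= r &
    r `^ s <= d `^ s + t].
  exists r; split => //; first by rewrite r0.
  move=> y /dist; rewrite lee_fin ler_norml /= in_itv/= => /andP[? ?].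
  by apply/andP; split; lra.
have [d_gt0|] := ltP 0 d; first by exists d; rewrite d_gt0 de lexx lerDl ltW.
move=> d_le0; have -> : d = 0 by apply/eqP; rewrite eq_le d_le0 d0.
have [->|sN0] := eqVneq s 0.
  by exists e; rewrite e0 lexx !powRr0 lerDl !ltW.
(* A single point with [s > 0]: here [diam_pow] vanishes, and [r <= t]^ s^-1[keeps]r [^ s] below the
   slack [t]. *)
exists (Num.min e (t `^ s^-1)); split.
- by rewrite lt_min e0 powR_gt0// ge_min lexx.
- by rewrite le_min ltW//= powR_ge0.
- rewrite powR0// add0r (@le_trans _ _ ((t `^ s^-1) `^ s))//.
    apply: ge0_ler_powR; rewrite ?nnegrE ?powR_ge0// ?le_min ?(ltW e0)/= ?powR_ge0//.
    by rewrite ge_min lexx orbT.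
  by rewrite -powRrM mulVf// powRr1// ltW.
Qed.

Lemma hausdorff_measure_eq0 s (A : set R) :
  (forall e t : R, 0 < e -> 0 < t -> (hausdorff_content s e A <= t%:E)%E) ->
  hausdorff_measure s A = 0%E.
Proof.
move=> h; apply/eqP; rewrite eq_le; apply/andP; split; last first.
  apply: (@le_trans _ _ (hausdorff_content s 1 A)).
    apply: le_ereal_inf_tmp => _ [U _ <-].
    by apply: nneseries_ge0 => i _ _; exact: diam_pow_ge0.
  by apply: ereal_sup_ubound; exists 1 => //=.
apply: ge_ereal_sup => _ [e e0 <-].
apply/lee_addgt0Pr => t t0; rewrite add0e; exact: h.
Qed.

Lemma hausdorff_measure0_cover s e t (A : set R) : 0 < e -> 0 < t ->
  hausdorff_measure s A = 0%E ->
  exists U : nat -> set R, [/\ A `<=` \bigcup_i U i,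
    (forall i, (diam (U i) <= e%:E)%E) &
    (\sum_(0 <= i <oo) diam_pow s (U i) < t%:E)%E].
Proof.
move=> e0 t0 A0.
have : (hausdorff_content s e A < t%:E)%E.
  rewrite (@le_lt_trans _ _ (hausdorff_measure s A))//.
    by apply: ereal_sup_ubound; exists e.
  by rewrite A0 lte_fin.
by move=> /ereal_inf_lt[_ [U [AU Ue] <-] Ut]; exists U.
Qed.

(** A finite list becomes a countable cover by padding with [set0], whose diameter is [-oo] and
    whose [diam_pow] is 0 even for [s = 0]. *)
Lemma hausdorff_content_le s e (A : set R) (l : seq (set R)) (b : R) :
  A `<=` \bigcup_(i in [set i | (i < size l)%N]) nth set0 l i ->
  0 <= e ->
  (forall U, U \in l -> (diam U <= e%:E /\ diam_pow s U <= b%:E)%E) ->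
  (hausdorff_content s e A <= ((size l)%:R * b)%:E)%E.
Proof.
move=> Al e0 lb.
apply: (@le_trans _ _ (\sum_(0 <= i <oo) diam_pow s (nth set0 l i))%E).
  apply: ereal_inf_lbound; exists (nth set0 l) => //; split.
    by move=> x /Al[i _ xi]; exists i.
  move=> i; have [il|li] := ltnP i (size l).
    by have [] := lb _ (mem_nth set0 il).
  rewrite nth_default//; apply: ge_ereal_sup => _ [x []].
rewrite (nneseries_split 0 (size l)); last by move=> *; exact: diam_pow_ge0.
rewrite add0n [X in (_ + X)%E]eseries0 ?adde0; last first.
  by move=> i li _; rewrite nth_default// diam_pow_set0.
rewrite (@le_trans _ _ (\sum_(0 <= i < size l) b%:E)%E)//.
  rewrite big_nat_cond [X in (_ <= X)%E]big_nat_cond.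
  apply: lee_sum => i /andP[/andP[_ il] _].
  by have [] := lb _ (mem_nth set0 il).
by rewrite sumEFin lee_fin big_const_nat subn0 iter_addr_0 mulr_natl.
Qed.

End Diameter.

(** * Union bound, slack, and counting of separated intervals *)

Lemma size_le_sum_count (T : eqType) (P : nat -> pred T) M (l : seq T) :
  (forall x, x \in l -> exists2 i, (i < M)%N & P i x) ->
  (size l <= \sum_(0 <= i < M) count (P i) l)%N.
Proof.
elim: l => //= x l IH xl; rewrite big_split/= -add1n leq_add//; last first.
  by apply: IH => y yl; apply: xl; rewrite inE yl orbT.
have [i iM Pix] := xl x (mem_head _ _).
by rewrite big_mkord (bigD1 (Ordinal iM))//= Pix.
Qed.

(** Bounds the total slack spent on enlarging the members of a cover, however many of them are
    kept. *)
Lemma sum_geometric_half_le (R : realType) (t : R) M : 0 <= t ->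
  \sum_(0 <= i < M) t / 2 ^+ i.+1 <= t.
Proof.
move=> t0; suff -> : \sum_(0 <= i < M) t / 2 ^+ i.+1 = t - t / 2 ^+ M.
  by rewrite gerBl divr_ge0// exprn_ge0.
elim: M => [|M IH]; first by rewrite big_geq// expr0 divr1 subrr.
have p0 : (2 : R) ^+ M != 0 by rewrite expf_neq0.
by rewrite big_nat_recr//= IH exprS; field.
Qed.

Section Counting.
Context {R : realType} {T : eqType}.
Variables (l h : T -> R) (d g : R).
Implicit Type (r : seq T).

(** Successive right endpoints differ by at least [d + g], and the last one is at most [b + d]
    because its interval starts by [b]. *)
Lemma pairwise_span x r b :
  {in x :: r, forall y, h y = l y + d} ->
  pairwise (fun y z => h y + g <= l z) (x :: r) ->
  {in x :: r, forall y, l y <= b} ->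
  h x + (size r)%:R * (d + g) <= b + d.
Proof.
elim: r x => [|y r IH] x hd.
  by move=> _ xb; rewrite mul0r addr0 hd ?mem_head// lerD2r xb ?mem_head.
move=> /= /andP[/andP[xy _] yr] bnd.
have H : l y + d + (size r)%:R * (d + g) <= b + d.
  rewrite -hd ?inE ?eqxx ?orbT//.
  by apply: IH => // z zr; [apply: hd|apply: bnd]; rewrite inE zr orbT.
have -> : (size r).+1%:R * (d + g) = (size r)%:R * (d + g) + (d + g) :> R.
  by rewrite -natr1 mulrDl mul1r.
lra.
Qed.

(** The intervals that meet [a, b] have their right endpoints in [a, b + d], spaced by at least
    [d + g]. *)
Lemma count_meet_le r a b : 0 <= d -> 0 <= g -> a <= b ->
  {in r, forall y, h y = l y + d} ->
  pairwise (fun y z => h y + g <= l z) r ->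
  ((count (fun y => (l y <= b) && (a <= h y)) r)%:R - 1) * (d + g) <= b - a + d.
Proof.
move=> d0 g0 ab hd pw; rewrite -size_filter.
have := pairwise_filter (fun y => (l y <= b) && (a <= h y)) pw.
have := mem_subseq (filter_subseq (fun y => (l y <= b) && (a <= h y)) r).
have := filter_all (fun y => (l y <= b) && (a <= h y)) r.
case: (seq.filter _ _) => [|x q] qP qr pwq /=.
  rewrite sub0r mulN1r; lra.
have /= /andP[/andP[_ ax] _] := qP.
have H : h x + (size q)%:R * (d + g) <= b + d.
  apply: pairwise_span => // y yq; first exact/hd/qr.
  by move/allP: qP => /(_ _ yq)/andP[].
rewrite -natr1 addrK; lra.
Qed.

End Counting.

(** * Enumeration of the words of a given length *)

Section Words.
Variable n : nat -> nat.

(** The order is lexicographic, hence the left-to-right order of the intervals on the line, which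
    the counting arguments rely on. *)
Fixpoint word_seq (k : nat) : seq (seq nat) :=
  if k is k'.+1 then
    flatten [seq [seq rcons s i | i <- iota 1 (n k)] | s <- word_seq k']
  else [:: [::]].

Lemma words_rcons k s i :
  words n k.+1 (rcons s i) <-> words n k s /\ (1 <= i <= n k.+1)%N.
Proof.
rewrite /words /= size_rcons; split.
  move=> [[sk] si]; split; last first.
    by have := si k (ltnSn k); rewrite nth_rcons sk ltnn eqxx.
  split=> // j jk; have := si j (ltnW jk).
  by rewrite nth_rcons sk jk.
move=> [[sk si] ik]; split; first by rewrite sk.
move=> j; rewrite ltnS leq_eqVlt nth_rcons sk => /predU1P[->|jk].
  by rewrite ltnn eqxx.
by rewrite jk si.
Qed.

Lemma mem_word_seq k s : s \in word_seq k <-> words n k s.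
Proof.
elim: k s => [|k IH] s.
  rewrite inE; split=> [/eqP->//|[]].
  by case: s.
split=> [/flatten_mapP[t /IH tk /mapP[i + ->]]|].
  by rewrite mem_iota add1n ltnS => ik; apply/words_rcons.
case/lastP: s => [[]//|t i] /words_rcons[/IH tk ik].
apply/flatten_mapP; exists t => //; apply/mapP; exists i => //.
by rewrite mem_iota add1n ltnS.
Qed.

Lemma size_word_seq k : size (word_seq k) = (\prod_(1 <= i < k.+1) n i)%N.
Proof.
elim: k => [|k IH]; first by rewrite big_geq.
rewrite big_nat_recr//= -IH size_flatten /shape -map_comp.
rewrite (eq_map (g := fun=> n k.+1)); last first.
  by move=> s /=; rewrite size_map size_iota.
by elim: (word_seq k) => //= _ l ->; rewrite mulSn.
Qed.

End Words.

(** * Basic intervals and their gaps *)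

Section MoranSet.
Context {R : realType} (n : nat -> nat) (c : nat -> R).
Hypothesis n_ge2 : forall k, (1 <= k)%N -> (2 <= n k)%N.
Hypothesis c_gt0 : forall k, (1 <= k)%N -> 0 < c k.
Hypothesis nc_lt1 : forall k, (1 <= k)%N -> (n k)%:R * c k < 1.
Variables lo hi : seq nat -> R.
Hypothesis moranE : homogeneous_moran n c lo hi.
Variables Lgap Rgap : nat -> R.
Hypothesis Lgap_ge0 : forall k, (1 <= k)%N -> 0 <= Lgap k.
Hypothesis Rgap_ge0 : forall k, (1 <= k)%N -> 0 <= Rgap k.
Hypothesis eta_left : forall k s, words n k s -> eta n lo hi s 0 = Lgap k.+1.
Hypothesis eta_right : forall k s, words n k s ->
  eta n lo hi s (n k.+1) = Rgap k.+1.

Definition nwords k := (\prod_(1 <= i < k.+1) n i)%N.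
(* The length of the core of I_s, [s] of length k: the convex hull of its
   children, which contains all of E in I_s, up to shared endpoints. *)
Definition core_len k := delta c k - Lgap k.+1 - Rgap k.+1.

Lemma natn_gt0 k : 0 < (n k.+1)%:R :> R.
Proof. by rewrite ltr0n (leq_trans _ (n_ge2 (ltn0Sn k))). Qed.

Lemma words_child1 k s : words n k s -> words n k.+1 (rcons s 1%N).
Proof. by move=> sk; apply/words_rcons; split=> //; rewrite (leq_trans _ (n_ge2 _)). Qed.

Lemma deltaS k : delta c k.+1 = delta c k * c k.+1.
Proof. by rewrite /delta big_nat_recr. Qed.

Lemma delta_gt0 k : 0 < delta c k.
Proof.
elim: k => [|k IH]; first by rewrite /delta big_geq.
by rewrite deltaS mulr_gt0// c_gt0.
Qed.

Lemma nwordsS k : nwords k.+1 = (nwords k * n k.+1)%N.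
Proof. by rewrite /nwords big_nat_recr. Qed.

Lemma nwords_gt0 k : 0 < (nwords k)%:R :> R.
Proof.
elim: k => [|k IH]; first by rewrite /nwords big_geq.
by rewrite nwordsS natrM mulr_gt0 // natn_gt0.
Qed.

(** [moran_root] equates sets, not endpoints: [lo [::]] and 0 are compared by testing that each lies
    in both descriptions of the interval. *)
Lemma root_lo : lo [::] = 0.
Proof.
have h : lo [::] <= hi [::] by apply: (moran_le moranE (k := 0)).
have E := moran_root moranE.
have : moran_itv lo hi [::] (lo [::]) by rewrite /moran_itv /= in_itv/= lexx.
have : `[0, 1]%classic (0 : R) by rewrite /= in_itv/= lexx ler01.
rewrite E -{1}E /moran_itv /= !in_itv/= => /andP[l0 _] /andP[l1 _].
by apply/eqP; rewrite eq_le l0 l1.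
Qed.

Lemma root_hi : hi [::] = 1.
Proof.
have h : lo [::] <= hi [::] by apply: (moran_le moranE (k := 0)).
have E := moran_root moranE.
have : moran_itv lo hi [::] (hi [::]) by rewrite /moran_itv /= in_itv/= lexx andbT.
have : `[0, 1]%classic (1 : R) by rewrite /= in_itv/= lexx ler01.
rewrite E -{1}E /moran_itv /= !in_itv/= => /andP[_ l0] /andP[_ l1].
by apply/eqP; rewrite eq_le l0 l1.
Qed.

Lemma hiE k s : words n k s -> hi s = lo s + delta c k.
Proof.
elim: k s => [|k IH] s.
  by case: s => [_|? ? []//]; rewrite root_lo root_hi /delta big_geq// add0r.
case/lastP: s => [[]//|s i] /words_rcons[sk ik].
have := moran_ratio moranE (k := k.+1) isT sk ik.
rewrite (IH _ sk) addrAC subrr add0r => /(congr1 ( *%R^~ (delta c k))).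
rewrite mulfVK ?gt_eqF ?delta_gt0// deltaS mulrC => <-.
by rewrite addrC subrK.
Qed.

Lemma child_bounds k s i : words n k s -> (1 <= i <= n k.+1)%N ->
  lo s <= lo (rcons s i) /\ hi (rcons s i) <= hi s.
Proof.
move=> sk ik; have sik : words n k.+1 (rcons s i) by apply/words_rcons.
have le := moran_le moranE sik.
have sub := moran_sub moranE (k := k.+1) isT sk ik.
have : moran_itv lo hi s (lo (rcons s i)).
  by apply: sub; rewrite /moran_itv /= in_itv/= lexx.
have : moran_itv lo hi s (hi (rcons s i)).
  by apply: sub; rewrite /moran_itv /= in_itv/= lexx andbT.
by rewrite /moran_itv /= !in_itv/= => /andP[_ ->] /andP[->].
Qed.

Lemma words_bounds k s : words n k s -> 0 <= lo s /\ hi s <= 1.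
Proof.
elim: k s => [|k IH] s.
  by case: s => [_|? ? []//]; rewrite root_lo root_hi.
case/lastP: s => [[]//|s i] /words_rcons[sk ik].
have [? ?] := IH _ sk; have [? ?] := child_bounds sk ik.
by split; lra.
Qed.

Lemma lo_first k s : words n k s -> lo (rcons s 1%N) = lo s + Lgap k.+1.
Proof. by move=> sk; rewrite -(eta_left sk) /eta eqxx; ring. Qed.

Lemma hi_last k s : words n k s -> hi (rcons s (n k.+1)) = hi s - Rgap k.+1.
Proof.
move=> sk; rewrite -(eta_right sk) /eta.
have [-> _] := sk; rewrite eqxx ifF; first by ring.
by apply/negbTE; rewrite -lt0n (leq_trans _ (n_ge2 _)).
Qed.

Lemma inner_gapsP k s j : words n k s -> (1 <= j < n k.+1)%N ->
  inner_gaps n lo hi k.+1 (lo (rcons s j.+1) - hi (rcons s j)).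
Proof.
move=> sk jn; exists s => //; exists j; first by rewrite /=; lia.
have [sz _] := sk; rewrite /eta sz ifF; last by apply/negbTE; lia.
by rewrite ifF//; apply/negbTE; lia.
Qed.

(** These bounds make [sup] and [inf] of the gaps genuine; on unbounded sets both would be default
    values. *)
Lemma inner_gaps_bounds k g : inner_gaps n lo hi k.+1 g -> 0 <= g <= 1.
Proof.
rewrite /inner_gaps /= => -[s sk [j jn <-]]; have [sz _] := sk.
rewrite /eta sz ifF; last by apply/negbTE; lia.
rewrite ifF; last by apply/negbTE; lia.
have := moran_ordered moranE (k := k.+1) (l := j) isT sk _.
rewrite jn => /(_ isT) ord.
have jk : (1 <= j <= n k.+1)%N by lia.
have jk' : (1 <= j.+1 <= n k.+1)%N by lia.
have sjk : words n k.+1 (rcons s j) by apply/words_rcons.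
have sjk' : words n k.+1 (rcons s j.+1) by apply/words_rcons.
have [? ?] := words_bounds sjk; have [? ?] := words_bounds sjk'.
have := moran_le moranE sjk; have := moran_le moranE sjk'.
lra.
Qed.

(** A witness at every level: it makes the set of gaps nonempty, and lengths common to all words of
    a level can be computed on it. *)
Lemma words_ones k : words n k (nseq k 1%N).
Proof.
split; first by rewrite size_nseq.
by move=> j jk; rewrite nth_nseq jk/= (leq_trans _ (n_ge2 _)).
Qed.

Lemma alpha_min_ge0 k : 0 <= alpha_min n lo hi k.+1.
Proof.
apply: lb_le_inf; last by move=> g /inner_gaps_bounds/andP[].
have := n_ge2 (ltn0Sn k) => nk.
by eexists; apply: (inner_gapsP (words_ones k) (j := 1%N)); lia.
Qed.

Lemma alpha_min_le k s j : words n k s -> (1 <= j < n k.+1)%N ->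
  hi (rcons s j) + alpha_min n lo hi k.+1 <= lo (rcons s j.+1).
Proof.
move=> sk jn; rewrite addrC -lerBrDr; apply: ge_inf; last exact: inner_gapsP.
by exists 0 => g /inner_gaps_bounds/andP[].
Qed.

Lemma alpha_max_ge k s j : words n k s -> (1 <= j < n k.+1)%N ->
  lo (rcons s j.+1) <= hi (rcons s j) + alpha_max n lo hi k.+1.
Proof.
move=> sk jn; rewrite addrC -lerBlDr; apply: ub_le_sup; last exact: inner_gapsP.
by exists 1 => g /inner_gaps_bounds/andP[].
Qed.

Lemma child_sep k s i j : words n k s -> (1 <= i)%N -> (i < j)%N -> (j <= n k.+1)%N ->
  hi (rcons s i) + alpha_min n lo hi k.+1 <= lo (rcons s j).
Proof.
move=> sk i1; elim: j => // j IH; rewrite ltnS leq_eqVlt => /predU1P[<-|ij] jn.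
  by apply: alpha_min_le => //; lia.
have jn' : (1 <= j < n k.+1)%N by lia.
have := IH ij (ltnW jn); have := alpha_min_le sk jn'.
have sjk : words n k.+1 (rcons s j) by apply/words_rcons; split => //; lia.
rewrite (hiE sjk); have := delta_gt0 k.+1; have := alpha_min_ge0 k; lra.
Qed.

(** * Lengths of the cores *)

Lemma core_lenE k s : words n k s ->
  core_len k = hi (rcons s (n k.+1)) - lo (rcons s 1%N).
Proof. by move=> sk; rewrite (lo_first sk) (hi_last sk) (hiE sk) /core_len; ring. Qed.

(** The children lie side by side in the core; the induction adds them from left to right. *)
Lemma child_core_len_le k : (n k.+1)%:R * delta c k.+1 <= core_len k.
Proof.
have sk := words_ones k; set s := nseq k 1%N in sk.
suff H i : (i < n k.+1)%N ->
    lo (rcons s 1%N) + i.+1%:R * delta c k.+1 <= hi (rcons s i.+1).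
  have nk := n_ge2 (ltn0Sn k); have nkE : (n k.+1).-1.+1 = n k.+1 by lia.
  have := H (n k.+1).-1; rewrite nkE leqnn => /(_ isT).
  by rewrite (core_lenE sk); lra.
elim: i => [|i IH] ik; first by rewrite mul1r -hiE//; exact: words_child1.
have := alpha_min_le sk (j := i.+1) ik; have := alpha_min_ge0 k.
have si : words n k.+1 (rcons s i.+2) by apply/words_rcons.
have := IH (ltnW ik); rewrite (hiE si) -[i.+2%:R]natr1; lra.
Qed.

(** The core consists of [n k.+1] children and one gap fewer. Counting an extra gap is harmless
    since [alpha_max] is nonnegative, and gives a product. *)
Lemma core_len_le_children k :
  core_len k <= (n k.+1)%:R * (delta c k.+1 + alpha_max n lo hi k.+1).
Proof.
have sk := words_ones k; set s := nseq k 1%N in sk.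
set A := alpha_max _ _ _ _; have nk := n_ge2 (ltn0Sn k).
have A0 : 0 <= A.
  have jn : (1 <= 1 < n k.+1)%N by lia.
  have := alpha_max_ge sk jn; have := alpha_min_le sk jn.
  have := alpha_min_ge0 k; rewrite -/A; lra.
suff H i : (i < n k.+1)%N ->
    hi (rcons s i.+1) <= lo (rcons s 1%N) + i.+1%:R * (delta c k.+1 + A).
  have nkE : (n k.+1).-1.+1 = n k.+1 by lia.
  have := H (n k.+1).-1; rewrite nkE leqnn => /(_ isT).
  by rewrite (core_lenE sk); lra.
elim: i => [|i IH] ik.
  by rewrite mul1r (hiE (words_child1 sk)); lra.
have := alpha_max_ge sk (j := i.+1) ik; rewrite -/A.
have si : words n k.+1 (rcons s i.+2) by apply/words_rcons.
have := IH (ltnW ik); rewrite (hiE si) -[i.+2%:R]natr1; lra.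
Qed.

Lemma core_len_gt0 k : 0 < core_len k.
Proof.
by apply: lt_le_trans (child_core_len_le k); rewrite mulr_gt0// ?natn_gt0// delta_gt0.
Qed.

Lemma core_len_le_delta k : core_len k <= delta c k.
Proof.
have := Lgap_ge0 (ltn0Sn k); have := Rgap_ge0 (ltn0Sn k); rewrite /core_len; lra.
Qed.

(** A core of the next level fits into a child, and at least two children fit side by side into the
    core. *)
Lemma core_lenS_le k : core_len k.+1 <= core_len k / 2.
Proof.
have := child_core_len_le k; have := core_len_le_delta k.+1; have := delta_gt0 k.+1.
have : 2 <= (n k.+1)%:R :> R by rewrite ler_nat n_ge2.
nra.
Qed.

Lemma core_len_antitone j k : (j <= k)%N -> core_len k <= core_len j.
Proof.
elim: k => [|k IH]; first by rewrite leqn0 => /eqP->.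
rewrite leq_eqVlt => /predU1P[->//|/IH].
have := core_lenS_le k; have := core_len_gt0 k; lra.
Qed.

Lemma core_len_small e : 0 < e -> exists k, core_len k < e.
Proof.
(* Halving gives more than this bound, but the form [k.+1%:R^-1] matches the Archimedean
   property. *)
move=> e0; have H k : core_len k <= k.+1%:R^-1.
  elim: k => [|k IH].
    by rewrite invr1; have := core_len_le_delta 0; rewrite /delta big_geq.
  apply: le_trans (core_lenS_le k) _; apply: (@le_trans _ _ (k.+1%:R^-1 / 2)).
    by rewrite ler_pM2r.
  rewrite -invfM lef_pV2 ?posrE ?mulr_gt0// -natrM ler_nat; lia.
have [k ke] := ltr_add_invr (y := 0) (x := e) e0.
by exists k; rewrite (le_lt_trans (H k))//; move: ke; rewrite add0r.
Qed.

(** Level 0 is excluded: without end gaps its core is all of [0, 1], and the logarithm of its length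
    is 0. *)
Lemma core_len_lt1 k : (1 <= k)%N -> core_len k < 1.
Proof.
move=> k1; have := core_len_antitone k1; have := core_lenS_le 0.
have := core_len_le_delta 0; rewrite {1}/delta big_geq//; lra.
Qed.

Lemma ln_core_len_lt0 k : (1 <= k)%N -> ln (core_len k) < 0.
Proof. by move=> k1; rewrite ln_lt0// core_len_gt0 core_len_lt1. Qed.

(** A product of factors [n j * c j < 1]. It later forces the exponents under consideration to be at
    most 1. *)
Lemma nwords_core_len_le1 k : (nwords k)%:R * core_len k <= 1.
Proof.
apply: (@le_trans _ _ ((nwords k)%:R * delta c k)).
  by rewrite ler_pM2l ?nwords_gt0// core_len_le_delta.
elim: k => [|k IH]; first by rewrite /nwords /delta !big_geq// mulr1.
rewrite nwordsS deltaS natrM mulrACA -[leRHS]mulr1 ler_pM//.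
- by rewrite mulr_ge0 ?(ltW (nwords_gt0 _))// ltW// delta_gt0.
- by rewrite mulr_ge0 ?ler0n// ltW// c_gt0.
- by rewrite ltW// nc_lt1.
Qed.

(** * Left-to-right order of the intervals of a level *)

Lemma child_core k s i : words n k s -> (1 <= i <= n k.+1)%N ->
  lo s + Lgap k.+1 <= lo (rcons s i) /\ hi (rcons s i) <= hi s - Rgap k.+1.
Proof.
move=> sk /andP[i1 ik]; rewrite -(lo_first sk) -(hi_last sk).
have g0 := alpha_min_ge0 k.
have d0 := delta_gt0 k.+1.
have hiS j : (1 <= j <= n k.+1)%N -> hi (rcons s j) = lo (rcons s j) + delta c k.+1.
  by move=> jk; apply: hiE; apply/words_rcons.
split.
- move: i1; rewrite leq_eqVlt => /predU1P[<-//|i1].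
  have := child_sep sk (leqnn 1) i1 ik; rewrite hiS; first by lra.
  by rewrite (leq_trans _ (n_ge2 _)).
- move: ik; rewrite leq_eqVlt => /predU1P[<-//|ik].
  have := child_sep sk i1 ik (leqnn _); rewrite [hi (rcons s (n _))]hiS; first by lra.
  by rewrite leqnn (leq_trans _ (n_ge2 _)).
Qed.

Definition children k s := [seq rcons s i | i <- iota 1 (n k.+1)].

Lemma mem_children k s t : t \in children k s ->
  exists2 i, (1 <= i <= n k.+1)%N & t = rcons s i.
Proof. by move=> /mapP[i + ->]; rewrite mem_iota add1n ltnS => ?; exists i. Qed.

Lemma children_sep k s : words n k s ->
  pairwise (fun t u => hi t + alpha_min n lo hi k.+1 <= lo u) (children k s).
Proof.
move=> sk; rewrite pairwise_map.
have : all (fun i => 1 <= i <= n k.+1)%N (iota 1 (n k.+1)).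
  by apply/allP => i; rewrite mem_iota add1n ltnS.
move/(sub_in_pairwise (r := ltn)); apply => [i j|].
  rewrite !unfold_in => /andP[i1 _] /andP[_ jn] ij /=.
  exact: child_sep.
by rewrite -(sorted_pairwise ltn_trans) iota_ltn_sorted.
Qed.

(** The summand 0 is the separation [g] of [count_meet_le]: intervals with different parents may
    share an endpoint. *)
Lemma word_seq_sorted k :
  pairwise (fun s t => hi s + 0 <= lo t) (word_seq n k).
Proof.
elim: k => // k /= pw.
have : forall t, t \in word_seq n k -> words n k t by move=> t /mem_word_seq.
elim: (word_seq n k) pw => //= s l IH /andP[sl pw] ls.
have sk := ls s (mem_head _ _).
rewrite pairwise_cat; apply/and3P; split.
- apply/allrelP => x y /mem_children[i ik ->] /flatten_mapP[t tl].
  move=> /mem_children[j jk ->].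
  have tk : words n k t by apply: ls; rewrite inE tl orbT.
  have [_ ?] := child_bounds sk ik; have [? _] := child_bounds tk jk.
  by move/allP: sl => /(_ _ tl); lra.
- apply: sub_pairwise (children_sep sk) => t u.
  by have := alpha_min_ge0 k; lra.
- by apply: IH => // t tl; apply: ls; rewrite inE tl orbT.
Qed.

(** * Points, compactness and natural covers of the Moran set *)

Lemma words_prefix m k s x : (m <= k)%N -> words n k s -> moran_itv lo hi s x ->
  exists2 t, words n m t & moran_itv lo hi t x.
Proof.
elim: k s => [|k IH] s; first by rewrite leqn0 => /eqP-> ? ?; exists s.
rewrite leq_eqVlt => /predU1P[->|mk]; first by exists s.
case/lastP: s => [[]//|s i] /words_rcons[sk ik] xsi.
by apply: (IH s) => //; apply: (moran_sub moranE (k := k.+1)) xsi.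
Qed.

(** Nested intervals: descend through first children forever and take the supremum of the left
    endpoints. *)
Lemma moran_point k s : words n k s ->
  exists2 x, moran_set n lo hi x & lo s <= x <= hi s.
Proof.
move=> sk; pose t j := iter j (rcons^~ 1%N) s.
have tk j : words n (k + j) (t j).
  by elim: j => [|j IH]; rewrite ?addn0// addnS; exact: words_child1.
have mono i j : (i <= j)%N -> lo (t i) <= lo (t j) /\ hi (t j) <= hi (t i).
  elim: j => [|j IH]; first by rewrite leqn0 => /eqP->.
  rewrite leq_eqVlt => /predU1P[->//|/IH[ti tj]].
  have [|? ?] := child_bounds (tk j) (i := 1%N).
    by rewrite (leq_trans _ (n_ge2 _)).
  by split; [apply: le_trans ti _|apply: le_trans tj].
have lohi i j : lo (t i) <= hi (t j).
  have [ij _] := mono _ _ (leq_maxl i j); have [_ ji] := mono _ _ (leq_maxr i j).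
  by apply: le_trans ij (le_trans _ ji); exact: (moran_le moranE (tk _)).
pose x := sup (range (lo \o t)).
have xt j : lo (t j) <= x <= hi (t j).
  apply/andP; split.
    by apply: ub_le_sup; [exists (hi s) => _ [i _ <-]; exact: (lohi i 0%N)|exists j].
  by apply: ge_sup; [exists (lo (t 0%N)), 0%N|move=> _ [i _ <-]; exact: lohi].
exists x; last exact: (xt 0%N).
(* The chain member of index [m] has length [k + m >= m], so its prefix of length [m] gives an
   interval of level [m] around [x]. *)
move=> m _; have [|u um xu] := words_prefix (leq_addl k m) (tk m) (x := x).
  by rewrite /moran_itv /= in_itv/=.
by exists u.
Qed.

Lemma moran_set_compact : compact (moran_set n lo hi).
Proof.
have -> : moran_set n lo hi = `[0, 1]%classic `&` moran_set n lo hi.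
  apply/esym/setIidPr => x /(_ 0%N I)[s s0].
  have [? ?] := words_bounds s0.
  by rewrite /moran_itv /= !in_itv/= => /andP[? ?]; apply/andP; split; lra.
apply: compact_closedI; first exact: segment_compact.
apply: closed_bigI => k _; apply: closed_bigcup.
  have -> : words n k = [set` word_seq n k].
    by apply/seteqP; split=> s /mem_word_seq.
  exact: finite_seq.
by move=> s _; exact: interval_closed.
Qed.

(** Reading membership at level [k.+1] puts the point in a child, hence in the core of the parent.
    This is why the formula has [core_len] in place of [delta]. *)
Lemma moran_set_cover k x : moran_set n lo hi x ->
  exists2 s, s \in word_seq n k & lo s + Lgap k.+1 <= x <= hi s - Rgap k.+1.
Proof.
move=> /(_ k.+1 I)[t].
case/lastP: t => [[]//|s i] /words_rcons[sk ik].
rewrite /moran_itv /= in_itv/= => /andP[? ?].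
exists s; first exact/mem_word_seq.
by have [? ?] := child_core sk ik; apply/andP; split; lra.
Qed.

(** * Counting the basic intervals that meet a given interval *)

Definition meets (a b : R) (s : seq nat) := (lo s <= b) && (a <= hi s).

Definition core_meets k (a b : R) (s : seq nat) :=
  (lo s + Lgap k.+1 <= b) && (a <= hi s - Rgap k.+1).

Definition meet_count k a b := count (meets a b) (word_seq n k).

(** Passes from one parent to a whole level: a parent satisfying [q] contributes at most [M]
    children, any other parent none. *)
Lemma count_children_le k (p q : pred (seq nat)) (M : R) : 0 <= M ->
  (forall s, words n k s ->
    (count p (children k s))%:R <= M * (q s)%:R) ->
  (count p (word_seq n k.+1))%:R <= M * (count q (word_seq n k))%:R.
Proof.
move=> M0 H; have : forall t, t \in word_seq n k -> words n k t by move=> t /mem_word_seq.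
rewrite [word_seq n k.+1]/=; elim: (word_seq n k) => [|s l IH] ls /=.
  by rewrite mulr0.
rewrite count_cat !natrD mulrDr lerD//; first by apply/H/ls/mem_head.
by apply: IH => t tl; apply: ls; rewrite inE tl orbT.
Qed.

(** The fraction of words whose interval meets [a, b] cannot grow with the level: a child that is
    met has a parent that is met. Cross-multiplication avoids division. *)
Lemma meet_count_div_nwords_antitone k (a b : R) K : (k <= K)%N ->
  (meet_count K a b * nwords k <= meet_count k a b * nwords K)%N.
Proof.
elim: K => [|K IH]; first by rewrite leqn0 => /eqP->.
rewrite leq_eqVlt => /predU1P[->//|kK].
suff H : (meet_count K.+1 a b <= n K.+1 * meet_count K a b)%N.
  rewrite nwordsS mulnA (leq_trans (leq_mul H (leqnn _)))// -mulnA mulnC leq_mul//.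
  exact: IH.
rewrite -(ler_nat R) natrM; apply: count_children_le => [//|s sK].
have [sab|sab] := boolP (meets a b s).
  by rewrite mulr1 ler_nat (leq_trans (count_size _ _))// size_map size_iota.
rewrite mulr0 lern0 -leqn0 leqNgt -has_count; apply: contra sab.
move=> /hasP[t /(mem_children)[i ik ->]].
have [? ?] := child_bounds sK ik.
by rewrite /meets => /andP[? ?]; apply/andP; split; lra.
Qed.

(** With [d = core_len k] and [g = 0], [count_meet_le] bounds the count minus 1 by a number less
    than 2. *)
Lemma core_count_le2 k (a b : R) : a <= b -> b - a < core_len k ->
  (count (core_meets k a b) (word_seq n k) <= 2)%N.
Proof.
move=> ab bak; rewrite leqNgt; apply/negP => c3.
have := @count_meet_le R _ (fun s => lo s + Lgap k.+1) (fun s => hi s - Rgap k.+1)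
  (core_len k) 0 (word_seq n k) a b (ltW (core_len_gt0 k)) (lexx 0) ab.
set m := count _ _.
move: c3; rewrite -/m -(ler_nat R) => c3.
have st := core_len_gt0 k.
move=> H; suff : (m%:R - 1) * (core_len k + 0) <= b - a + core_len k by nra.
apply: H => [s /mem_word_seq sk|]; first by rewrite (hiE sk) /core_len; ring.
apply: sub_pairwise (word_seq_sorted k) => s t /=.
have := Lgap_ge0 (ltn0Sn k); have := Rgap_ge0 (ltn0Sn k); lra.
Qed.

(** * Lower bound: nonzero Hausdorff measure *)

Section Comparison.
Implicit Types a b : R.

Variable C : R.
Hypothesis C_gt0 : 0 < C.
Hypothesis core_len_leC : forall k,
  core_len k <= C * ((n k.+1)%:R * (delta c k.+1 + alpha_min n lo hi k.+1)).

(** At most two cores are met. In each, separation allows at most [2 + (b - a) / (d + g)] children,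
    and [core_len_leC] bounds [1 / (d + g)] by [C * n k.+1 / core_len k]. *)
Lemma meets_countS_le k a b : a <= b -> b - a < core_len k ->
  (meet_count k.+1 a b)%:R <= 4 + 2 * C * (n k.+1)%:R * ((b - a) / core_len k).
Proof.
move=> ab bak; set g := alpha_min n lo hi k.+1; set d := delta c k.+1.
have g0 : 0 <= g := alpha_min_ge0 k.
have d0 : 0 < d := delta_gt0 k.+1.
have st := core_len_gt0 k; have n0 := natn_gt0 k.
pose M := 2 + C * (n k.+1)%:R * ((b - a) / core_len k).
have M0 : 0 <= M.
  have Cn := mulr_gt0 C_gt0 n0.
  have : 0 <= (b - a) / core_len k by apply: divr_ge0; [rewrite subr_ge0|exact: ltW].
  by rewrite /M; nra.
have -> : 4 + 2 * C * (n k.+1)%:R * ((b - a) / core_len k) = M * 2 :> R.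
  by rewrite /M; ring.
apply: (@le_trans _ _ (M * (count (core_meets k a b) (word_seq n k))%:R)); last first.
  by apply: ler_wpM2l => //; rewrite ler_nat; exact: core_count_le2.
apply: count_children_le => // s sk.
have [qs|qs] := boolP (core_meets k a b s); last first.
  rewrite mulr0 lern0 -leqn0 leqNgt -has_count; apply: contra qs.
  move=> /hasP[t /mem_children[i ik ->]].
  have [? ?] := child_core sk ik.
  by rewrite /meets /core_meets => /andP[? ?]; apply/andP; split; lra.
rewrite mulr1.
have := count_meet_le (ltW d0) g0 ab _ (children_sep sk).
rewrite -/(meets a b); set m := count _ _ => H.
have {}H : (m%:R - 1) * (d + g) <= b - a + d.
  by apply: H => _ /mem_children[i ik ->]; apply: hiE; apply/words_rcons.
have dg : 0 < d + g by lra.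
rewrite -(ler_pM2r dg) /M -[in leLHS](subrK 1 m%:R) mulrDl mul1r.
rewrite (le_trans (lerD H (lexx _)))//.
have : b - a <= (b - a) / core_len k * (C * ((n k.+1)%:R * (d + g))).
  rewrite -[leLHS](divfK (lt0r_neq0 st)) ler_wpM2l ?core_len_leC//.
  by apply: divr_ge0; [rewrite subr_ge0|exact: ltW].
lra.
Qed.

(* [k] is the level at which the core length first drops to [b - a] or below; past it,
   [meet_count_div_nwords_antitone] propagates the bound. *)
Lemma meets_count_powR (s : R) k0 a b : 0 <= s ->
  (forall k, (k0 <= k)%N -> 1 <= (nwords k)%:R * core_len k `^ s) ->
  a < b -> b - a < core_len k0 -> (1 <= k0)%N ->
  exists k, forall K, (k <= K)%N ->
    (meet_count K a b)%:R <= (4 + 2 * C) * (b - a) `^ s * (nwords K)%:R.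
Proof.
move=> s0 mass ab abk0 k01; have ba : 0 < b - a by lra.
have s1 : s <= 1.
  have st := core_len_gt0 k0; have n0 := nwords_gt0 k0.
  have stl := ln_core_len_lt0 k01.
  have := ln_ge0 (mass k0 (leqnn _)); have := ln_le0 (nwords_core_len_le1 k0).
  rewrite !lnM ?posrE ?powR_gt0// ln_powR; nra.
have ex : exists k, core_len k <= b - a.
  by have [k kab] := core_len_small ba; exists k; exact: ltW.
(* The minimal level is not 0, since [b - a < core_len k0 <= core_len 0]; its predecessor [k] thus
   has [b - a < core_len k]. *)
have [[|k] kab mink] := ex_minnP ex.
  by have := core_len_antitone (leq0n k0); lra.
have abk : b - a < core_len k.
  by rewrite ltNge; apply/negP => /mink; rewrite ltnn.
have k0k : (k0 <= k)%N.
  by rewrite leqNgt; apply/negP => /core_len_antitone; lra.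
have st := core_len_gt0 k; have st1 := core_len_gt0 k.+1; have ns := natn_gt0 k.
have n0 := nwords_gt0 k; have n1 := nwords_gt0 k.+1.
have nS : (nwords k.+1)%:R = (nwords k)%:R * (n k.+1)%:R :> R by rewrite nwordsS natrM.
set x := (b - a) / core_len k; have x0 : 0 < x by rewrite divr_gt0.
have x1 : x <= x `^ s by rewrite ger1_powR// x0 ler_pdivrMr// mul1r ltW.
have abE : (b - a) `^ s = x `^ s * core_len k `^ s.
  by rewrite -powRM ?(ltW x0) ?(ltW st)// divfK// gt_eqF.
have ab1 : 1 <= (b - a) `^ s * (nwords k.+1)%:R.
  rewrite mulrC (le_trans (mass k.+1 (leqW k0k)))// ler_pM2l//.
  by apply: ge0_ler_powR => //; rewrite nnegrE ltW.
have abn : (n k.+1)%:R * x <= (b - a) `^ s * (nwords k.+1)%:R.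
  rewrite nS abE [leRHS](_ : _ =
    (n k.+1)%:R * x `^ s * ((nwords k)%:R * core_len k `^ s)); last by ring.
  apply: (@le_trans _ _ ((n k.+1)%:R * x `^ s)); first by rewrite ler_pM2l.
  by rewrite ler_peMr ?mass// mulr_ge0 ?powR_ge0// ltW.
have main : (meet_count k.+1 a b)%:R <=
    (4 + 2 * C) * (b - a) `^ s * (nwords k.+1)%:R.
  apply: le_trans (meets_countS_le (ltW ab) abk) _.
  have := ler_wpM2l (ltW C_gt0) abn; rewrite -/x; nra.
exists k.+1 => K kK.
have := meet_count_div_nwords_antitone a b kK; rewrite -(ler_nat R) !natrM => H.
by rewrite -(ler_pM2r n1) (le_trans H)// mulrAC ler_wpM2r.
Qed.

(* Instead of a mass distribution, fractions of words of a deep level K are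
   counted: an interval V meets at most a fraction |V|^s of them, up to a
   constant, and by compactness finitely many slightly enlarged sets of a cover
   already meet all of them. *)
Lemma hausdorff_measure_neq0 (s : R) k0 : 0 <= s -> (1 <= k0)%N ->
  (forall k, (k0 <= k)%N -> 1 <= (nwords k)%:R * core_len k `^ s) ->
  hausdorff_measure s (moran_set n lo hi) <> 0%E.
Proof.
move=> s0 k01 mass; pose D := (4 + 2 * C) * 4 `^ s; pose t := (2 * D)^-1.
have D0 : 0 < D by rewrite mulr_gt0 ?powR_gt0// addr_gt0// mulr_gt0.
have t0 : 0 < t by rewrite invr_gt0 mulr_gt0.
(* Dividing by 5 makes the enlarged length [4 * r] strictly less than [core_len k0]. *)
have st := core_len_gt0 k0; pose e := core_len k0 / 5.
have e0 : 0 < e by rewrite divr_gt0.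
move=> /(hausdorff_measure0_cover e0 t0)[U [EU Ue Ut]].
have fat i : exists p : R * R, U i !=set0 ->
    [/\ 0 < p.2 <= e, U i `<=` `]p.1 - 2 * p.2, p.1 + 2 * p.2[%classic &
     ((p.2 `^ s)%:E <= diam_pow s (U i) + (t / 2 ^+ i.+1)%:E)%E].
  have [Ui|Ui] := pselect (U i !=set0); last by exists (0, 0).
  have ti : 0 < t / 2 ^+ i.+1 by rewrite divr_gt0// exprn_gt0.
  by have [x [r xr]] := diam_pow_fatten s0 e0 ti Ui (Ue i); exists (x, r).
have [p pP] := choice fat.
pose a i := (p i).1 - 2 * (p i).2; pose b i := (p i).1 + 2 * (p i).2.
have lvl i : exists k, U i !=set0 -> forall K, (k <= K)%N ->
    (meet_count K (a i) (b i))%:R <= D * (p i).2 `^ s * (nwords K)%:R.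
  have [Ui|Ui] := pselect (U i !=set0); last by exists 0%N.
  have [/andP[p0 pe] _ _] := pP i Ui.
  have abE : b i - a i = 4 * (p i).2 by rewrite /a /b; ring.
  have [||k kP] := meets_count_powR s0 mass (a := a i) (b := b i) _ _ k01.
  - by rewrite -subr_gt0 abE mulr_gt0.
  - by rewrite abE; move: pe; rewrite /e; lra.
  exists k => _ K /kP; rewrite abE powRM ?(ltW p0)//.
  by rewrite /D !mulrA.
have [kk kkP] := choice lvl.
have := moran_set_compact; rewrite compact_cover.
move=> /(_ nat [set i | U i !=set0] (fun i => `]a i, b i[%classic)).
case=> [i _|x /EU[i _ Uix]|F FU EF]; first exact: itv_open.
  have Ui : U i !=set0 by exists x.
  by exists i => //; have [_ + _] := pP i Ui; apply.
(* [M] exceeds every index of the finite subcover, and [K] is deep enough for the count of every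
   member of index below [M]. *)
pose M := (\max_(i <- finmap.enum_fset F) i).+1; pose K := (\max_(i < M) kk i)%N.
pose P i : pred (seq nat) := fun u => `[< U i !=set0 >] && meets (a i) (b i) u.
pose f i : R := if `[< U i !=set0 >] then (p i).2 `^ s else 0.
have count_f i : (i < M)%N ->
    (count (P i) (word_seq n K))%:R <= D * f i * (nwords K)%:R.
  move=> iM; rewrite /P /f; case: asboolP => [Ui|_]; last first.
    by rewrite /= count_pred0 mulr0 mul0r.
  apply: (kkP i Ui K); exact: (leq_bigmax (F := fun i : 'I_M => kk i) (Ordinal iM)).
(* Each interval of level [K] contains a point of the Moran set, so the subcover meets them all. *)
have words_f : 1 <= D * \sum_(0 <= i < M) f i.
  rewrite -(ler_pM2r (nwords_gt0 K)) mul1r.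
  rewrite mulr_sumr mulr_suml.
  apply: (@le_trans _ _ (\sum_(0 <= i < M) (count (P i) (word_seq n K))%:R)).
    rewrite -natr_sum ler_nat /nwords -size_word_seq.
    apply: size_le_sum_count => u /mem_word_seq uK.
    have [x /EF[i Fi xi] /andP[ux xu]] := moran_point uK.
    exists i; first by rewrite ltnS; apply: leq_bigmax_seq.
    apply/andP; split; first by apply/asboolP; apply: set_mem (FU i Fi).
    move: xi; rewrite /= in_itv/= => /andP[ax xb].
    by apply/andP; split; lra.
  rewrite big_nat_cond [leRHS]big_nat_cond; apply: ler_sum => i /andP[/andP[_ iM] _].
  exact: count_f.
have sum_f : \sum_(0 <= i < M) f i < 2 * t.
  rewrite -lte_fin -sumEFin.
  apply: (@le_lt_trans _ _ (\sum_(0 <= i < M) (diam_pow s (U i) + (t / 2 ^+ i.+1)%:E))%E).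
    apply: lee_sum => i _; rewrite /f; case: asboolP => [Ui|_].
      by have [] := pP i Ui.
    by rewrite adde_ge0 ?diam_pow_ge0// lee_fin divr_ge0 ?(ltW t0)// exprn_ge0.
  rewrite big_split/= sumEFin mulr_natl mulr2n EFinD lte_leD//.
    by apply: le_lt_trans Ut; apply: nneseries_lim_ge => *; exact: diam_pow_ge0.
  by rewrite lee_fin sum_geometric_half_le// ltW.
have : D * (2 * t) = 1 by rewrite /t; field; apply: lt0r_neq0.
nra.
Qed.

End Comparison.

(** * Comparison of the dimension with the inferior limit *)

Local Notation dim_seq k :=
  ((ln (nwords k)%:R / - ln (core_len k) : R)%:E).

(* The only consequence of conditions (A), (B), (C) that is needed: the left
   endpoints of the children of I_s are, up to a constant factor, separated as
   well as if they were evenly spread. *)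
Lemma exists_comparison :
  (exists2 w1 : R, 0 < w1 & forall k : nat, (1 <= k)%N ->
     alpha_max n lo hi k <= w1 * alpha_min n lo hi k)
  \/ (exists2 w2 : R, 0 < w2 & forall k : nat, (1 <= k)%N ->
     alpha_max n lo hi k <= w2 * delta c k)
  \/ (exists2 w3 : R, 0 < w3 & forall k : nat, (1 <= k)%N ->
     w3 * delta c k.-1 <= (n k)%:R * alpha_min n lo hi k) ->
  exists2 C : R, 0 < C & forall k,
    core_len k <= C * ((n k.+1)%:R * (delta c k.+1 + alpha_min n lo hi k.+1)).
Proof.
case=> [[w w0 H]|[[w w0 H]|[w w0 H]]].
- exists (1 + w) => [|k]; first by lra.
  apply: le_trans (core_len_le_children k) _.
  rewrite mulrCA ler_pM2l ?natn_gt0//.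
  have := H k.+1 isT; have := alpha_min_ge0 k; have := delta_gt0 k.+1; nra.
- exists (1 + w) => [|k]; first by lra.
  apply: le_trans (core_len_le_children k) _.
  rewrite mulrCA ler_pM2l ?natn_gt0//.
  have := H k.+1 isT; have := alpha_min_ge0 k; have := delta_gt0 k.+1; nra.
- exists w^-1 => [|k]; first by rewrite invr_gt0.
  apply: le_trans (core_len_le_delta k) _.
  rewrite mulrC ler_pdivlMr// mulrC (le_trans (H k.+1 isT))//.
  by rewrite ler_pM2l ?natn_gt0// lerDr ltW// delta_gt0.
Qed.

Lemma dim_seq_ge0 k : (0 <= dim_seq k)%E.
Proof.
case: k => [|k]; first by rewrite /nwords big_geq// ln1 mul0r.
rewrite lee_fin divr_ge0//; last by rewrite oppr_ge0 ltW// ln_core_len_lt0.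
by rewrite ln_ge0// -[1]/(1%:R) ler_nat -(ltr_nat R) nwords_gt0.
Qed.

Lemma hausdorff_dim_ge :
  (exists2 C : R, 0 < C & forall k,
    core_len k <= C * ((n k.+1)%:R * (delta c k.+1 + alpha_min n lo hi k.+1))) ->
  (limn_einf (fun k => dim_seq k) <= hausdorff_dim (moran_set n lo hi))%E.
Proof.
move=> [C C0 HC]; apply: le_ereal_inf_tmp => _ [s [s0 Hs] <-].
rewrite leNgt; apply/negP => /lt_limn_einf[k0 k0P].
apply: (hausdorff_measure_neq0 C0 HC s0 (leq_maxr k0 1)) Hs => k.
rewrite geq_max => /andP[k0k k1].
have l0 := ln_core_len_lt0 k1; have := k0P k k0k.
rewrite lee_fin ler_pdivlMr ?oppr_gt0// => H.
have p0 := mulr_gt0 (nwords_gt0 k) (powR_gt0 s (core_len_gt0 k)).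
rewrite -ler_ln ?posrE// ln1 lnM ?posrE ?powR_gt0 ?core_len_gt0 ?nwords_gt0//.
rewrite ln_powR; lra.
Qed.

(** The cores of a suitable deep level form the cover. Half of the excess [e] gives [N * l]^ (l0 + e
    / 2) <= 1[, with]l0[the inferior limit; the other half makes the remaining factor]l [^ (e / 2)]
    small. *)
Lemma hausdorff_dim_le :
  (hausdorff_dim (moran_set n lo hi) <= limn_einf (fun k => dim_seq k))%E.
Proof.
have := limn_einf_ge dim_seq_ge0.
case E : limn_einf => [l| |] l0; [|by rewrite leey|by []].
apply/lee_addgt0Pr => e e0; rewrite -EFinD; rewrite lee_fin in l0.
apply: ereal_inf_lbound; exists (l + e) => //; split; first by lra.
apply: hausdorff_measure_eq0 => d t d0 t0.
(* Below this threshold the cores have diameter at most [d], and the [e / 2]-th power of their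
   length is at most [t]. *)
have m0 : 0 < Num.min d (t `^ (e / 2)^-1) by rewrite lt_min d0 powR_gt0.
have [k1] := core_len_small m0; rewrite lt_min => /andP[k1d k1t].
have [] := @limn_einf_lt _ (fun k => dim_seq k) (l + e / 2)%:E _ (maxn k1 1).
  by rewrite E lte_fin; lra.
move=> k; rewrite geq_max => /andP[k1k k0].
have lk := ln_core_len_lt0 k0; have st := core_len_gt0 k.
have kk1 := core_len_antitone k1k.
rewrite lte_fin ltr_pdivrMr ?oppr_gt0// => H.
pose core s := `[lo s + Lgap k.+1, hi s - Rgap k.+1]%classic.
have core_ok s : words n k s ->
    hi s - Rgap k.+1 - (lo s + Lgap k.+1) = core_len k.
  by move=> sk; rewrite (hiE sk) /core_len; ring.
have core_le s : words n k s -> lo s + Lgap k.+1 <= hi s - Rgap k.+1.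
  by move=> sk; rewrite -subr_ge0 core_ok// ltW.
apply: le_trans (hausdorff_content_le (l := [seq core s | s <- word_seq n k])
  (b := core_len k `^ (l + e)) _ (ltW d0) _) _.
- move=> x /(moran_set_cover k)[s sk xs].
  exists (index s (word_seq n k)); first by rewrite /= size_map index_mem.
  by rewrite (nth_map [::]) ?index_mem// nth_index.
- move=> _ /mapP[s /mem_word_seq sk ->]; split.
    apply: le_trans (diam_itv_le (core_le _ sk)) _.
    by rewrite lee_fin core_ok//; lra.
  apply: le_trans (diam_pow_itv_le _ (core_le _ sk)) _; first by lra.
  by rewrite core_ok.
rewrite size_map size_word_seq -/(nwords k) lee_fin.
have -> : l + e = l + e / 2 + e / 2 by lra.
rewrite powRD; last by rewrite (lt0r_neq0 st) implybT.
rewrite mulrA -[leRHS]mul1r ler_pM ?mulr_ge0 ?powR_ge0 ?ler0n//.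
  rewrite -ler_ln ?posrE ?mulr_gt0 ?powR_gt0 ?nwords_gt0//.
  rewrite ln1 lnM ?posrE ?powR_gt0 ?nwords_gt0// ln_powR; lra.
have -> : t = (t `^ (e / 2)^-1) `^ (e / 2).
  by rewrite -powRrM mulVf ?powRr1 ?(ltW t0)// gt_eqF// divr_gt0.
by apply: ge0_ler_powR; rewrite ?nnegrE ?powR_ge0//; lra.
Qed.

End MoranSet.

Theorem theorem1 (R : realType) (n : nat -> nat) (c : nat -> R)
    (n_ge2 : forall k : nat, (1 <= k)%N -> (2 <= n k)%N)
    (c_gt0 : forall k : nat, (1 <= k)%N -> 0 < c k)
    (nc_lt1 : forall k : nat, (1 <= k)%N -> (n k)%:R * c k < 1)
    (lo hi : seq nat -> R)
    (moranE : homogeneous_moran n c lo hi)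
    (Lgap Rgap : nat -> R)
    (Lgap_ge0 : forall k : nat, (1 <= k)%N -> 0 <= Lgap k)
    (Rgap_ge0 : forall k : nat, (1 <= k)%N -> 0 <= Rgap k)
    (eta_left : forall (k : nat) (s : seq nat), words n k s ->
       eta n lo hi s 0 = Lgap k.+1)
    (eta_right : forall (k : nat) (s : seq nat), words n k s ->
       eta n lo hi s (n k.+1) = Rgap k.+1)
    (conditions :
       (exists2 w1 : R, 0 < w1 & forall k : nat, (1 <= k)%N ->
          alpha_max n lo hi k <= w1 * alpha_min n lo hi k)
       \/ (exists2 w2 : R, 0 < w2 & forall k : nat, (1 <= k)%N ->
          alpha_max n lo hi k <= w2 * delta c k)
       \/ (exists2 w3 : R, 0 < w3 & forall k : nat, (1 <= k)%N ->
          w3 * delta c k.-1 <= (n k)%:R * alpha_min n lo hi k)) :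
  hausdorff_dim (moran_set n lo hi) =
  limn_einf (fun k : nat =>
    (ln ((\prod_(1 <= i < k.+1) n i)%N%:R : R)
       / - ln (delta c k - Lgap k.+1 - Rgap k.+1))%:E).
Proof.
apply/eqP; rewrite eq_le; apply/andP; split.
  exact: hausdorff_dim_le.
by apply: hausdorff_dim_ge => //; exact: exists_comparison.
Qed.
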